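(* Let $\rho$ be any density matrix on $\mathbb{C}^d$, let $\{|a_i\rangle\}_{i=1}^d$ and $\{|b_j\rangle\}_{j=1}^d$ be two orthonormal bases of $\mathbb{C}^d$, let $U_{ij}=\langle a_i|b_j\rangle$, and let $p_i=\langle a_i|\rho|a_i\rangle$, $q_j=\langle b_j|\rho|b_j\rangle$. Let $c=(c_1,c_2,\dots,c_{d^2})$ be the $d^2$ numbers $|U_{ij}|^2$ arranged in decreasing order, and put $C=(1+\sqrt{c_1})/2$. Let $S(\rho)=-\mathrm{Tr}\,\rho\ln\rho$. (i) If $Q=(Q_1,\dots,Q_{d^2})$ is a probability vector with $Q_1\ge Q_2\ge\dots\ge Q_{d^2}$ such that $p\otimes q\prec Q$, then $$H(p)+H(q)\ge -\ln(Q\cdot c)+S(\rho),$$ where $Q\cdot c=\sum_{n}Q_nc_n$. (ii) $$H(p)+H(q)\ge -\ln\left[c_1C^2+c_2(1-C^2)\right]+S(\rho).$$ (iii) If $Q$ is as in (i), then for each pair $(k,l)\in\{1,\dots,d\}^2$ let $h_{kl}\in\mathbb{R}^{d^2}$ be the vector of the $d^2$ numbers $|U_{kj}|^2|U_{il}|^2$, $(i,j)\in\{1,\dots,d\}^2$, arranged in decreasing order, and let $g=(g_1,\dots,g_{d^2})$ be the $d^2$ numbers $-\ln(Q\cdot h_{kl})$, $(k,l)\in\{1,\dots,d\}^2$, arranged in increasing order. Then $$H(p)+H(q)\ge \frac12\sum_{n=1}^{d^2}Q_n g_n+S(\rho).$$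
   Context: $H(p)=-\sum_i p_i\ln p_i$ is the Shannon entropy (natural logarithm). $p\otimes q$ denotes the $d^2$-dimensional probability vector with entries $p_iq_j$. For probability vectors $x,y$ of the same length, $x\prec y$ (majorization) means $\sum_{k=1}^n x^{\downarrow}_k\le\sum_{k=1}^n y^{\downarrow}_k$ for all $n$, with equality for $n$ equal to the full length, where $x^{\downarrow}$ is $x$ sorted in decreasing order. *)

(* Defs.v *)
From HB Require Import structures.
From mathcomp Require Import all_boot all_order all_algebra.
From mathcomp Require Import boolp classical_sets reals exp.
From mathcomp Require Import complex.
Set Implicit Arguments. Unset Strict Implicit. Unset Printing Implicit Defensive.
Import Order.TTheory GRing.Theory Num.Theory.
Local Open Scope ring_scope.

Section Defs.
Variable R : realType.
Local Notation C := (complex R).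

Definition cconj (z : C) : C := @Complex R (complex.Re z) (- complex.Im z).
Definition sqmod (z : C) : R := complex.Re z ^+ 2 + complex.Im z ^+ 2.

Definition adj m n (A : 'M[C]_(m, n)) : 'M[C]_(n, m) := \matrix_(i, j) cconj (A j i).

Definition cdot n (u v : 'cV[C]_n) : C := \sum_i cconj (u i 0) * v i 0.

(* {a_i} is an orthonormal family of d vectors in C^d, i.e. an orthonormal basis *)
Definition orthonormal_basis d (a : 'I_d -> 'cV[C]_d) : Prop :=
  forall i j, cdot (a i) (a j) = (i == j)%:R.

Definition density_matrix d (rho : 'M[C]_d) : Prop :=
  [/\ adj rho = rho,
      (forall v : 'cV[C]_d, complex.Im (cdot v (rho *m v)) = 0 /\ 0 <= complex.Re (cdot v (rho *m v)))
    & \tr rho = 1].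

Definition sandwich d (u : 'cV[C]_d) (rho : 'M[C]_d) (v : 'cV[C]_d) : C :=
  cdot u (rho *m v).

(* Shannon entropy (natural log) of a finite sequence; 0 ln 0 = 0 automatically *)
Definition shannon (s : seq R) : R := - \sum_(x <- s) x * ln x.

Definition decr (s : seq R) : seq R := sort (fun x y : R => y <= x) s.
Definition incr (s : seq R) : seq R := sort (fun x y : R => x <= y) s.

Definition majorized (x y : seq R) : Prop :=
  size x = size y /\
  (forall n, (n <= size x)%N ->
     \sum_(k < n) nth 0 (decr x) k <= \sum_(k < n) nth 0 (decr y) k) /\
  \sum_(k < size x) nth 0 (decr x) k = \sum_(k < size y) nth 0 (decr y) k.

Definition prob_vec (n : nat) (s : seq R) : Prop :=
  size s = n /\ (forall x, x \in s -> 0 <= x) /\ \sum_(x <- s) x = 1.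

Definition sdot (n : nat) (s t : seq R) : R := \sum_(k < n) nth 0 s k * nth 0 t k.

(* eigenvalues of a square complex matrix, with multiplicity: a sequence rs
   such that char_poly M = \prod_(z <- rs) ('X - z) (unique up to permutation,
   exists since C is algebraically closed) *)
Definition eigenvalues d (M : 'M[C]_d) : seq C :=
  xget [::] (fun rs : seq C => char_poly M = \prod_(z <- rs) ('X - z%:P)).

(* von Neumann entropy S(rho) = - Tr rho ln rho = - sum_lambda lambda ln lambda
   over the (real, nonnegative) eigenvalues of rho *)
Definition vN_entropy d (rho : 'M[C]_d) : R :=
  shannon [seq complex.Re z | z <- eigenvalues rho].

End Defs.

(* Main.v *)
(** H(p) - S(rho) is the relative entropy of rho with respect to its pinching
    sigma = sum_i p_i |a_i><a_i|, and relative entropy decreases under the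
    measurement in the basis b, which sends rho to q and sigma to
    s_j = sum_i p_i |U_ij|^2.  Hence
      H(p) + H(q) >= S(rho) - sum_j q_j ln s_j,
    and symmetrically with a and b exchanged.  Part (i) follows by concavity of
    ln and the rearrangement inequality for majorized vectors; part (iii) by
    averaging the two bounds; part (ii) because the weight p_i q_j sitting on
    the largest overlap is at most C^2, as p_i + q_j <= 1 + |U_ij|.

    The monotonicity of relative entropy is obtained by differentiating along
    the segment from sigma to rho.  In the eigenbases of rho and sigma the
    derivative is a sum of terms |W|^2 (l - m)^2 / (m + t (l - m)); completing
    the square against an operator Y diagonal in the basis b bounds it from
    below by the corresponding sum for q and s. *)

Require Import Defs.
From HB Require Import structures.
From mathcomp Require Import all_boot all_order all_algebra.
From mathcomp Require Import boolp classical_sets reals topology normedtype.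
From mathcomp Require Import derive realfun exp.
From mathcomp Require Import complex spectral.
From mathcomp Require Import ring lra.
Set Implicit Arguments. Unset Strict Implicit. Unset Printing Implicit Defensive.
Import Order.TTheory GRing.Theory Num.Theory.
Import numFieldNormedType.Exports.
Local Open Scope ring_scope.

(** * Weighted sums of logarithms along a segment *)

Section LogSegment.
Variable R : realType.

Lemma segment_gt0 (x y s : R) : 0 < x -> 0 < y -> 0 <= s <= 1 ->
  0 < x + s * (y - x).
Proof.
move=> x0 y0 /andP[s0 s1].
have [->|sn0] := eqVneq s 0; first by rewrite mul0r addr0.
have -> : x + s * (y - x) = (1 - s) * x + s * y by ring.
by rewrite ltr_wpDl ?mulr_gt0 ?mulr_ge0 ?subr_ge0 ?(ltW x0)// lt0r sn0.
Qed.

Lemma is_derive_ln_segment (x y s : R) : 0 < x + s * (y - x) ->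
  is_derive s 1 (fun t : R => ln (x + t * (y - x))) ((y - x) / (x + s * (y - x))).
Proof.
move=> u0.
have dl : is_derive s 1 (fun t : R => x + t * (y - x)) (y - x).
  have h := is_deriveD (is_derive_cst x s 1)
    (is_deriveM (is_derive_id s 1) (is_derive_cst (y - x) s 1)).
  by apply: is_derive_eq h _; rewrite /GRing.scale/= mulr0 mulr1 !add0r.
have := @is_derive1_comp _ _ (fun t : R => x + t * (y - x)) s _ _ (is_derive1_ln u0) dl.
by move=> h; apply: is_derive_eq h _; rewrite mulrC.
Qed.

Lemma is_derive_sum_seq (T : Type) (r : seq T) (f : T -> R -> R) (df : T -> R) (s : R) :
  (forall t, is_derive s 1 (f t) (df t)) ->
  is_derive s 1 (fun z => \sum_(t <- r) f t z) (\sum_(t <- r) df t).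
Proof.
move=> h; elim: r => [|t r ih].
  have -> : (fun z => \sum_(t <- [::]) f t z) = (fun=> 0).
    by apply/funext => z; rewrite big_nil.
  by rewrite big_nil; exact: is_derive_cst.
have -> : (fun z => \sum_(t0 <- t :: r) f t0 z) = f t \+ (fun z => \sum_(t <- r) f t z).
  by apply/funext => z; rewrite big_cons.
by rewrite big_cons; exact: is_deriveD.
Qed.

(** Mean value theorem for the sum of k_t ln(x_t + s (y_t - x_t)) between s = 0 and s = 1. The
    weights k may have either sign, so one application can compare two relative entropies at
    once. *)
Lemma sum_ln_le_of_segment_deriv (T : finType) (k x y : T -> R) :
  (forall t, k t != 0 -> 0 < x t /\ 0 < y t) ->
  (forall s : R, 0 < s < 1 ->
    0 <= \sum_t k t * (y t - x t) / (x t + s * (y t - x t))) ->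
  \sum_t k t * ln (x t) <= \sum_t k t * ln (y t).
Proof.
move=> pos dge0.
pose f s := \sum_t k t * ln (x t + s * (y t - x t)).
pose df s := \sum_t k t * (y t - x t) / (x t + s * (y t - x t)).
have f0 : f 0 = \sum_t k t * ln (x t).
  by apply: eq_bigr => t _; rewrite mul0r addr0.
have f1 : f 1 = \sum_t k t * ln (y t).
  by apply: eq_bigr => t _; rewrite mul1r addrC subrK.
have dfP (s : R) : 0 <= s <= 1 -> is_derive s 1 f (df s).
  move=> s01; apply: is_derive_sum_seq => t.
  (* A term of weight zero is constant in s, so its endpoints may vanish. *)
  have [->|kn0] := eqVneq (k t) 0.
    under [X in is_derive _ _ X]eq_fun do rewrite mul0r.
    by rewrite !mul0r; exact: is_derive_cst.
  have [x0 y0] := pos t kn0.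
  have h := is_derive_ln_segment (segment_gt0 x0 y0 s01).
  have := is_deriveZ (k t) h.
  by rewrite /GRing.scale/= mulrA.
have [s s01 /eqP] : exists2 c, c \in `]0, 1[%R & f 1 - f 0 = df c * (1 - 0).
  apply: MVT => // [s|].
    by rewrite in_itv/= => /andP[/ltW s0 /ltW s1]; apply: dfP; rewrite s0.
  apply: derivable_within_continuous => s; rewrite in_itv/= => s01.
  by case: (dfP s s01).
rewrite -f0 -f1 subr0 mulr1 -[_ <= _]subr_ge0 => /eqP ->.
by apply: dge0; move: s01; rewrite in_itv.
Qed.

End LogSegment.

(** * Majorization and rearrangement *)

Section Rearrangement.
Variable R : realType.
Implicit Types (x y : nat -> R) (s : seq R).

Local Notation ger := (fun u v : R => v <= u).

Let ger_total : total ger. Proof. by move=> u v; exact: le_total. Qed.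
Let ger_trans : transitive ger.
Proof. by move=> u v w vu wv; exact: le_trans wv vu. Qed.

Lemma perm_decr s : perm_eq (decr s) s.
Proof. by rewrite perm_sort. Qed.

Lemma decr_sorted s : sorted ger (decr s).
Proof. exact: sort_sorted. Qed.

Lemma size_decr s : size (decr s) = size s.
Proof. exact: size_sort. Qed.

(** Abel summation. The inductive invariant bounds the gap of the weighted sums below by the gap of
    the prefix sums times the current y_k; at the last index the prefix gap is zero because the
    totals agree. *)
Lemma sum_mul_le_abel n x x' y :
  (forall k, (k <= n)%N -> \sum_(i < k) x i <= \sum_(i < k) x' i) ->
  \sum_(i < n) x i = \sum_(i < n) x' i ->
  (forall k, (k.+1 < n)%N -> y k.+1 <= y k) ->
  \sum_(i < n) x i * y i <= \sum_(i < n) x' i * y i.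
Proof.
case: n => [|n] hle heq hy; first by rewrite !big_ord0.
suff H k : (k <= n)%N ->
    (\sum_(i < k.+1) x' i - \sum_(i < k.+1) x i) * y k
    <= \sum_(i < k.+1) x' i * y i - \sum_(i < k.+1) x i * y i.
  by have := H n (leqnn n); rewrite heq subrr mul0r subr_ge0.
elim: k => [|k ih] kn.
  by rewrite !big_ord_recr !big_ord0 /= !add0r mulrBl.
have := ih (ltnW kn); have := hle k.+1 (leqW kn).
have := hy k kn.
rewrite ![\sum_(i < k.+2) _]big_ord_recr /=.
set X := \sum_(i < k.+1) x i; set X' := \sum_(i < k.+1) x' i.
set S := \sum_(i < k.+1) _; set S' := \sum_(i < k.+1) _.
move=> yk XX h.
have : (X' - X) * y k.+1 <= (X' - X) * y k by rewrite ler_wpM2l ?subr_ge0.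
lra.
Qed.

(* Subtracting the threshold tau = s_(n-1) turns the sum of the n largest
   entries into the permutation-invariant sum of the positive parts. *)
Lemma sum_prefix_le_decr s s' n : perm_eq s' s -> (n <= size s)%N ->
  \sum_(i < n) nth 0 s' i <= \sum_(i < n) nth 0 (decr s) i.
Proof.
case: n => [|n] ss' ns; first by rewrite !big_ord0.
pose D := decr s; pose tau := nth 0 D n.
pose pp (u : R) := Num.max (u - tau) 0.
have pp0 u : 0 <= pp u by rewrite /pp le_max lexx orbT.
have le_nth i j : (i <= j)%N -> (j < size s)%N -> nth 0 D j <= nth 0 D i.
  move=> ij js; have := sorted_leq_nth ger_trans _ 0 (decr_sorted s).
  by move=> h; apply: h => //; rewrite ?inE ?size_decr ?(leq_ltn_trans ij).
have big_nthE t : size t = size s ->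
    \sum_(u <- t) pp u = \sum_(i < size s) pp (nth 0 t i).
  by move=> <-; rewrite (big_nth 0) big_mkord.
have splitE (F : nat -> R) : \sum_(i < size s) F i
    = \sum_(i < n.+1) F i + \sum_(n.+1 <= i < size s) F i.
  by rewrite -!(big_mkord xpredT F) (big_cat_nat (leq0n _) ns).
have eqpp : \sum_(i < size s) pp (nth 0 s' i) = \sum_(i < size s) pp (nth 0 D i).
  rewrite -!big_nthE ?size_decr ?(perm_size ss')//.
  by apply: perm_big; rewrite (perm_trans ss')// perm_sym perm_decr.
(* In the sorted list the first n+1 entries are at least tau and the others at most tau, so the
   positive parts keep exactly the prefix. *)
have topE : \sum_(i < size s) pp (nth 0 D i) = \sum_(i < n.+1) (nth 0 D i - tau).
  rewrite (splitE (fun i => pp (nth 0 D i))) [X in _ + X]big1_seq ?addr0 => [|i].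
    by apply: eq_bigr => i _; apply/max_idPl; rewrite subr_ge0 le_nth// -ltnS.
  rewrite mem_index_iota => /andP[_ /andP[ni iS]].
  by apply/max_idPr; rewrite subr_le0 le_nth// ltnW.
have : \sum_(i < n.+1) (nth 0 s' i - tau) <= \sum_(i < n.+1) (nth 0 D i - tau).
  rewrite -topE -eqpp (splitE (fun i => pp (nth 0 s' i))); apply: ler_wpDr.
    exact: sumr_ge0.
  by apply: ler_sum => i _; rewrite /pp le_max lexx.
by rewrite !big_split/= lerD2r.
Qed.

(** Reorder the indices so that g decreases. The prefix sums of the reordered f are at most those of
    f sorted, hence at most those of Q, and Abel summation against g concludes. *)
Lemma majorized_sum_mul_le (T : eqType) (r : seq T) (f g : T -> R) (Q : seq R) :
  sorted ger Q -> majorized [seq f t | t <- r] Q ->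
  \sum_(t <- r) f t * g t <= sdot (size r) Q (decr [seq g t | t <- r]).
Proof.
move=> sQ [sz [mle meq]].
have decrQ : decr Q = Q by rewrite /decr (sorted_sort ger_trans).
rewrite size_map in sz mle meq; rewrite -sz decrQ in meq mle.
pose r' := sort (fun t u => g u <= g t) r.
have pr : perm_eq r' r by rewrite perm_sort.
have szr : size r' = size r by rewrite size_sort.
have gr' : decr [seq g t | t <- r] = [seq g t | t <- r'].
  by rewrite /decr sort_map.
rewrite -(perm_big _ pr)/= gr' /sdot.
have -> : \sum_(t <- r') f t * g t = \sum_(k < size r)
    nth 0 [seq f t | t <- r'] k * nth 0 [seq g t | t <- r'] k.
  case: (r') szr => [|t0 r''] szr; first by rewrite -szr big_nil big_ord0.
  rewrite (big_nth t0) szr big_mkord; apply: eq_bigr => k _.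
  by rewrite !(nth_map t0) ?szr.
have pf : perm_eq [seq f t | t <- r'] [seq f t | t <- r] by exact: perm_map.
apply: (@sum_mul_le_abel _ (nth 0 _) (nth 0 _) (nth 0 _)).
- move=> k kr; apply: le_trans (mle k kr).
  by apply: sum_prefix_le_decr; rewrite ?size_map.
- rewrite -meq.
  have E (s : seq R) : size s = size r -> \sum_(i < size r) nth 0 s i = \sum_(u <- s) u.
    by move=> <-; rewrite (big_nth 0) big_mkord.
  rewrite !E ?size_decr ?size_map//; apply: perm_big.
  by rewrite (perm_trans pf)// perm_sym perm_decr.
- move=> k kr; rewrite -gr'.
  apply: (sorted_leq_nth ger_trans _ 0 (decr_sorted _)) => //;
    by rewrite ?inE ?size_decr ?size_map// ltnW.
Qed.

Lemma decr_opp (s : seq R) : decr [seq - u | u <- s] = [seq - u | u <- incr s].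
Proof.
rewrite /decr /incr sort_map; congr (map _ (sort _ _)).
by apply/funext => u; apply/funext => v /=; rewrite lerN2.
Qed.

Lemma majorized_sum_mul_ge (T : eqType) (r : seq T) (f g : T -> R) (Q : seq R) :
  sorted ger Q -> majorized [seq f t | t <- r] Q ->
  sdot (size r) Q (incr [seq g t | t <- r]) <= \sum_(t <- r) f t * g t.
Proof.
move=> sQ mQ; have := majorized_sum_mul_le (fun t => - g t) sQ mQ.
rewrite (map_comp -%R g) decr_opp.
have -> : sdot (size r) Q [seq - u | u <- incr [seq g t | t <- r]]
    = - sdot (size r) Q (incr [seq g t | t <- r]).
  rewrite /sdot -sumrN; apply: eq_bigr => k _.
  by rewrite (nth_map 0) ?mulrN// size_sort size_map.
have -> : \sum_(t <- r) f t * - g t = - \sum_(t <- r) f t * g t.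
  by rewrite -sumrN; apply: eq_bigr => t _; rewrite mulrN.
by rewrite lerN2.
Qed.

(** Splits off one index attaining the maximum. Since [rem] deletes a single occurrence, ties are
    allowed: the second sorted entry then equals the first. *)
Lemma decr_second (T : eqType) (r : seq T) (f : T -> R) : r != [::] ->
  exists2 t0, t0 \in r & f t0 = nth 0 (decr [seq f t | t <- r]) 0
    /\ forall t, t \in rem t0 r -> f t <= nth 0 (decr [seq f t | t <- r]) 1.
Proof.
move=> rn0; set D := decr _.
have szD : size D = size r by rewrite size_decr size_map.
have [u [v DE]] : exists u v, D = u :: v.
  by case: (D) szD rn0 => [|u v]; [case: (r)|exists u, v].
have : u \in [seq f t | t <- r] by rewrite -(perm_mem (perm_decr _)) -/D DE mem_head.
case/mapP => t0 t0r fE; exists t0 => //; rewrite DE/=; split=> // t trem.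
have : perm_eq v [seq f t | t <- rem t0 r].
  rewrite -(perm_cons u) -DE (perm_trans (perm_decr _))// fE -map_cons.
  by apply: perm_map; exact: perm_to_rem.
move/perm_mem/(_ (f t)); rewrite map_f// => ftv.
have := decr_sorted [seq f t | t <- r]; rewrite -/D DE /= => /path_sorted.
case: (v) ftv => // w v'; rewrite inE => /orP[/eqP ->//|ftv'] /=.
by rewrite path_sortedE// => /andP[/allP/(_ _ ftv')].
Qed.

End Rearrangement.

(** * Adjoints, unitary matrices and the spectral decomposition *)

Section Adjoint.
Variable R : realType.
Local Notation C := (complex R).
Local Notation "x %:C" := (real_complex R x).

Lemma cconjE (z : C) : cconj z = z^*.
Proof. by case: z. Qed.

Lemma adjE m n (A : 'M[C]_(m, n)) : adj A = map_mx Num.conj A^T.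
Proof. by apply/matrixP => i j; rewrite !mxE cconjE. Qed.

Lemma adj_mxE m n (A : 'M[C]_(m, n)) i j : adj A i j = cconj (A j i).
Proof. exact: mxE. Qed.

Lemma adjK m n (A : 'M[C]_(m, n)) : adj (adj A) = A.
Proof. by rewrite !adjE trmxCK. Qed.

Lemma adjM m n k (A : 'M[C]_(m, n)) (B : 'M[C]_(n, k)) :
  adj (A *m B) = adj B *m adj A.
Proof. by rewrite !adjE trmx_mul map_mxM. Qed.

Lemma sqmod_ge0 (z : C) : 0 <= sqmod z.
Proof. by rewrite addr_ge0// sqr_ge0. Qed.

Lemma sqmod_eq0 (z : C) : (sqmod z == 0) = (z == 0).
Proof.
by case: z => x y; rewrite /sqmod/= paddr_eq0 ?sqr_ge0// !sqrf_eq0 eq_complex.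
Qed.

Lemma sqmodC (z : C) : sqmod (cconj z) = sqmod z.
Proof. by case: z => x y; rewrite /sqmod/= sqrrN. Qed.

Lemma Re_mul_cconj (z : C) : complex.Re (z * cconj z) = sqmod z.
Proof. by case: z => x y; rewrite /sqmod/=; ring. Qed.

Lemma mul_cconj (z : C) : z * cconj z = (sqmod z)%:C.
Proof.
by case: z => x y; apply/eqP; rewrite eq_complex /sqmod/=; apply/andP;
  split; apply/eqP; ring.
Qed.

Lemma Re_sum (I : Type) (r : seq I) (P : pred I) (F : I -> C) :
  complex.Re (\sum_(i <- r | P i) F i) = \sum_(i <- r | P i) complex.Re (F i).
Proof. by apply: (big_morph _ _ _) => // -[? ?] []. Qed.

Lemma sum_Re_mul_cconj m n (A B : 'M[C]_(m, n)) i :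
  \sum_j complex.Re (A i j * cconj (B i j)) = complex.Re ((A *m adj B) i i).
Proof. by rewrite mxE Re_sum; apply: eq_bigr => j _; rewrite mxE. Qed.

Definition rdiag n (y : 'I_n -> R) : 'M[C]_n := diag_mx (\row_j (y j)%:C).

Lemma adj_rdiag n (y : 'I_n -> R) : adj (rdiag y) = rdiag y.
Proof.
apply/matrixP => i j; rewrite !mxE eq_sym.
by case: eqP => [->|_]; apply/eqP; rewrite eq_complex /= oppr0 !eqxx.
Qed.

Lemma rdiagM n (y y' : 'I_n -> R) :
  rdiag y *m rdiag y' = rdiag (fun j => y j * y' j).
Proof.
rewrite /rdiag mulmx_diag; congr diag_mx.
by apply/rowP => j; rewrite !mxE rmorphM.
Qed.

Lemma Re_rdiag_conj m n (Z : 'M[C]_(m, n)) (y : 'I_n -> R) i :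
  complex.Re ((Z *m rdiag y *m adj Z) i i) = \sum_j y j * sqmod (Z i j).
Proof.
rewrite mxE Re_sum; apply: eq_bigr => j _.
rewrite mul_mx_diag !mxE mulrAC mul_cconj -rmorphM/=; exact: mulrC.
Qed.

Definition unitary n (Z : 'M[C]_n) := adj Z *m Z = 1%:M.

Lemma unitaryr n (Z : 'M[C]_n) : unitary Z -> Z *m adj Z = 1%:M.
Proof. exact: mulmx1C. Qed.

Lemma unitary_adj n (Z : 'M[C]_n) : unitary Z -> unitary (adj Z).
Proof. by move=> hZ; rewrite /unitary adjK unitaryr. Qed.

Lemma unitaryM n (Z V : 'M[C]_n) : unitary Z -> unitary V -> unitary (Z *m V).
Proof.
by move=> hZ hV; rewrite /unitary adjM mulmxA -(mulmxA (adj V)) hZ mulmx1.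
Qed.

Lemma unitary_row_sum n (Z : 'M[C]_n) i : unitary Z -> \sum_j sqmod (Z i j) = 1.
Proof.
move=> /unitaryr hZ; under eq_bigr do rewrite -Re_mul_cconj.
by rewrite sum_Re_mul_cconj hZ mxE eqxx.
Qed.

Lemma cdotE n (u v : 'cV[C]_n) : cdot u v = (adj u *m v) 0 0.
Proof. by rewrite mxE; apply: eq_bigr => k _; rewrite mxE. Qed.

Lemma cconj_cdot n (u v : 'cV[C]_n) : cconj (cdot u v) = cdot v u.
Proof. by rewrite !cdotE -adj_mxE adjM adjK. Qed.

Definition basis_mx n (a : 'I_n -> 'cV[C]_n) : 'M[C]_n := \matrix_(i, j) a j i 0.

Lemma adj_basis_mx_mul n (a b : 'I_n -> 'cV[C]_n) i j :
  (adj (basis_mx a) *m basis_mx b) i j = cdot (a i) (b j).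
Proof. by rewrite mxE; apply: eq_bigr => k _; rewrite !mxE. Qed.

Lemma orthonormal_unitary n (a : 'I_n -> 'cV[C]_n) :
  orthonormal_basis a -> unitary (basis_mx a).
Proof. by move=> ha; apply/matrixP => i j; rewrite adj_basis_mx_mul ha mxE. Qed.

Lemma sandwich_basis_mx n (a : 'I_n -> 'cV[C]_n) (M : 'M[C]_n) i :
  sandwich (a i) M (a i) = (adj (basis_mx a) *m M *m basis_mx a) i i.
Proof.
rewrite -mulmxA mxE; apply: eq_bigr => k _; rewrite !mxE; congr (_ * _).
by apply: eq_bigr => l _; rewrite mxE.
Qed.

Lemma char_poly_conj n (P D : 'M[C]_n) : P \in unitmx ->
  char_poly (invmx P *m D *m P) = char_poly D.
Proof.
move=> uP; rewrite /char_poly.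
pose P' := map_mx polyC P; pose Pi := map_mx polyC (invmx P).
have PiP : Pi *m P' = 1%:M by rewrite -map_mxM mulVmx// map_mx1.
have -> : char_poly_mx (invmx P *m D *m P) = Pi *m char_poly_mx D *m P'.
  rewrite /char_poly_mx mulmxBr mulmxBl !map_mxM; congr (_ - _).
  by rewrite scalar_mxC -mulmxA PiP mulmx1.
by rewrite !det_mulmx mulrAC -det_mulmx PiP det1 mul1r.
Qed.

(** A Hermitian matrix is normal, hence unitarily diagonalizable. Each diagonal entry is the
    expectation of [rho] in an eigenvector, so positivity of [rho] makes it real and nonnegative. *)
Lemma density_spectral n (rho : 'M[C]_n) : density_matrix rho ->
  exists (P : 'M[C]_n) (lam : 'I_n -> R),
  [/\ unitary P, rho = adj P *m rdiag lam *m P, forall m, 0 <= lam m,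
      \sum_m lam m = 1 & vN_entropy rho = - \sum_m lam m * ln (lam m)].
Proof.
case=> rhoH rhoP rhoT.
have rhoN : rho \is normalmx by apply/normalmxP; rewrite -adjE rhoH.
have [[P D] /= Pu rhoE] := orthomx_spectral_subproof rhoN.
have Pinv := unitarymx_unit Pu.
have hP : unitary P.
  by apply: mulmx1C; rewrite adjE; apply/unitarymxP.
have PE : invmx P = adj P by rewrite adjE invmx_unitary.
(* The m-th eigenvector: the m-th column of [adj P]. *)
pose r m : 'cV[C]_n := adj P *m delta_mx m 0.
have DE m : cdot (r m) (rho *m r m) = D 0 m.
  rewrite cdotE.
  rewrite /r adjM adjK rhoE PE !mulmxA -(mulmxA _ P (adj P)) (unitaryr hP) mulmx1.
  rewrite -(mulmxA _ P (adj P)) (unitaryr hP) mulmx1.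
  have -> : adj (delta_mx m (0 : 'I_1)) = delta_mx (0 : 'I_1) m :> 'M[C]_(1, n).
    by apply/matrixP => i j; rewrite !mxE cconjE rmorph_nat andbC.
  by rewrite -rowE -colE !mxE eqxx.
pose lam m := complex.Re (D 0 m).
have lamE m : D 0 m = (lam m)%:C.
  have [h _] := rhoP (r m); rewrite DE in h.
  by rewrite /lam; case: (D 0 m) h => x y /= ->.
have DlE : diag_mx D = rdiag lam.
  by congr diag_mx; apply/rowP => m; rewrite mxE -lamE.
exists P, lam; split=> //.
- by rewrite -DlE -PE.
- by move=> m; have [_ h] := rhoP (r m); rewrite DE in h.
- have : \tr (diag_mx D) = 1.
    by rewrite -rhoT rhoE PE mxtrace_mulC mulmxA (unitaryr hP) mul1mx.
  by rewrite mxtrace_diag => /(congr1 (@complex.Re R)); rewrite Re_sum.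
- rewrite /vN_entropy /shannon /eigenvalues.
  have cpE : char_poly rho = \prod_(z <- [seq D 0 m | m <- enum 'I_n]) ('X - z%:P).
    rewrite rhoE char_poly_conj// char_poly_trig ?diag_mx_is_trig//.
    rewrite big_map big_enum /=; apply: eq_bigr => m _.
    by rewrite mxE eqxx.
  (* [eigenvalues] is an arbitrary chosen list of roots; unique factorization makes it a permutation
     of the diagonal, and the entropy sum does not depend on the order. *)
  case: xgetP => [rs _|/(_ _ cpE)//]; rewrite cpE => /prod_XsubC_eq rsE.
  by rewrite big_map -(perm_big _ rsE)/= big_map big_enum.
Qed.

End Adjoint.

(** * Monotonicity of relative entropy under a measurement *)

Section Measurement.
Variables (R : realType) (n : nat).
Local Notation C := (complex R).
Variables (Z V : 'M[C]_n) (lam mu : 'I_n -> R).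
Hypotheses (uZ : unitary Z) (uV : unitary V).

Let W := Z *m adj V.
Let q j := \sum_m lam m * sqmod (Z m j).
Let s j := \sum_i mu i * sqmod (V i j).
Let Y (y : 'I_n -> R) := Z *m rdiag y *m adj V.

(** [Y y] is the operator with eigenvalues y in the measured basis, written between the eigenbases
    of rho (rows) and sigma (columns). Weighting by lam or mu and summing gives traces of its
    products against rho or sigma, which see only the outcome probabilities q and s. *)
Lemma sum_Re_weighted (y y' : 'I_n -> R) (al be : R) :
  \sum_m \sum_i (al * lam m + be * mu i) *
    complex.Re (Y y m i * cconj (Y y' m i))
  = \sum_j y j * y' j * (al * q j + be * s j).
Proof.
have rowE m : \sum_i complex.Re (Y y m i * cconj (Y y' m i))
    = \sum_j y j * y' j * sqmod (Z m j).
  rewrite sum_Re_mul_cconj -Re_rdiag_conj -rdiagM /Y !adjM adjK adj_rdiag.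
  by rewrite !mulmxA -(mulmxA _ (adj V) V) uV mulmx1.
(* Column sums become row sums after passing to adjoints; then Z cancels as V did in [rowE]. *)
have colE i : \sum_m complex.Re (Y y m i * cconj (Y y' m i))
    = \sum_j y j * y' j * sqmod (V i j).
  have -> : \sum_m complex.Re (Y y m i * cconj (Y y' m i)) =
    \sum_m complex.Re (adj (Y y') i m * cconj (adj (Y y) i m)).
    by apply: eq_bigr => m _; rewrite !adj_mxE mulrC !cconjE conjCK.
  rewrite sum_Re_mul_cconj adjK /Y !adjM adjK adj_rdiag.
  rewrite !mulmxA -(mulmxA _ (adj Z) Z) uZ mulmx1 -(mulmxA V) rdiagM.
  by rewrite Re_rdiag_conj; apply: eq_bigr => j _; rewrite (mulrC (y j)).
under eq_bigr do under eq_bigr do rewrite mulrDl.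
under eq_bigr do rewrite big_split/=.
rewrite big_split/= [X in _ + X]exchange_big/=.
under eq_bigr => m _.
  under eq_bigr do rewrite -mulrA.
  rewrite -mulr_sumr -mulr_sumr rowE; over.
under [X in _ + X]eq_bigr => i _.
  under eq_bigr do rewrite -mulrA.
  rewrite -mulr_sumr -mulr_sumr colE; over.
rewrite -!mulr_sumr /q /s.
have swap (f : 'I_n -> R) (M : 'M[C]_n) :
    \sum_m f m * \sum_j y j * y' j * sqmod (M m j) =
    \sum_j y j * y' j * \sum_m f m * sqmod (M m j).
  under eq_bigr do rewrite mulr_sumr; rewrite exchange_big/=.
  apply: eq_bigr => j _; rewrite mulr_sumr; apply: eq_bigr => m _; exact: mulrCA.
rewrite !swap !mulr_sumr -big_split; apply: eq_bigr => j _ /=; ring.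
Qed.

Hypotheses (lam_ge0 : forall m, 0 <= lam m) (mu_ge0 : forall i, 0 <= mu i).

Let q_ge0 j : 0 <= q j.
Proof. by apply: sumr_ge0 => m _; rewrite mulr_ge0 ?sqmod_ge0. Qed.

Let s_ge0 j : 0 <= s j.
Proof. by apply: sumr_ge0 => m _; rewrite mulr_ge0 ?sqmod_ge0. Qed.

(* Completing the square: the difference of the two sides is
   (1 - t) |(l - m) w - u v|^2 / u with u = m + t (l - m). *)
Lemma resolvent_quadratic_ge (l m t : R) (w v : C) : 0 <= l -> 0 <= m -> 0 < t < 1 ->
  sqmod w * (l - m) + (1 - t) * ((l - m) * complex.Re (w * cconj v) *+ 2
     - (m + t * (l - m)) * sqmod v)
  <= sqmod w * l * (l - m) / (m + t * (l - m)).
Proof.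
move=> l0 m0 /andP[t0 t1].
have tm : 0 <= (1 - t) * m by rewrite mulr_ge0// subr_ge0 ltW.
have tl : 0 <= t * l by rewrite mulr_ge0// ltW.
have uE : m + t * (l - m) = (1 - t) * m + t * l by ring.
(* A zero denominator forces l = m = 0, and both sides vanish. *)
have [u0|un0] := eqVneq (m + t * (l - m)) 0.
  move: u0; rewrite uE => /eqP; rewrite paddr_eq0// => /andP[].
  rewrite !mulf_eq0 subr_eq0 !(gt_eqF t1, gt_eqF t0)/= => /eqP-> /eqP->.
  by rewrite !(subr0, mulr0, mul0r, addr0, mul0rn, sub0r, oppr0).
have {}u0 : 0 < m + t * (l - m) by rewrite lt0r un0 uE addr_ge0.
set u := m + t * (l - m) in un0 u0 *.
rewrite -subr_ge0.
have -> : sqmod w * l * (l - m) / u - (sqmod w * (l - m) +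
    (1 - t) * ((l - m) * complex.Re (w * cconj v) *+ 2 - u * sqmod v))
  = (1 - t) / u * (((l - m) * complex.Re w - u * complex.Re v) ^+ 2 +
       ((l - m) * complex.Im w - u * complex.Im v) ^+ 2).
  apply: (mulIf un0); rewrite mulrBl mulfVK// [RHS]mulrAC mulfVK//.
  rewrite /u; case: (w) (v) => [w1 w2] [v1 v2]; rewrite /sqmod/=; ring.
apply: mulr_ge0; last by rewrite addr_ge0 ?sqr_ge0.
by apply: divr_ge0; [rewrite subr_ge0|]; exact: ltW.
Qed.

(** With u = m + t (l - m) one has l (l - m) / u = (l - m) + (1 - t) (l - m)^2 / u. Both sides thus
    have a linear and a quadratic part; the quadratic one is bounded through
    [resolvent_quadratic_ge] with w and v entries of [W] and [Y y]. *)
Lemma measured_log_derivative_le (t : R) : 0 < t < 1 ->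
  \sum_j q j * (q j - s j) / (s j + t * (q j - s j)) <=
  \sum_m \sum_i sqmod (W m i) * lam m * (lam m - mu i) /
     (mu i + t * (lam m - mu i)).
Proof.
move=> t01; have /andP[t0 t1] := t01.
(* The maximizer of 2 (q_j - s_j) y - (s_j + t (q_j - s_j)) y^2; at this choice the lower bound is
   exactly the classical sum. *)
pose y j := (q j - s j) / (s j + t * (q j - s j)).
have WE : W = Y (fun=> 1).
  rewrite /Y /rdiag (_ : diag_mx _ = 1%:M) ?mulmx1//.
  by apply/matrixP => i j; rewrite !mxE.
have FW : \sum_m \sum_i (1 * lam m + -1 * mu i) * sqmod (W m i)
    = \sum_j (q j - s j).
  under eq_bigr do under eq_bigr do rewrite -Re_mul_cconj WE.
  rewrite sum_Re_weighted; apply: eq_bigr => j _; ring.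
have FY : \sum_m \sum_i (t * lam m + (1 - t) * mu i) * sqmod (Y y m i)
    = \sum_j y j * y j * (t * q j + (1 - t) * s j).
  under eq_bigr do under eq_bigr do rewrite -Re_mul_cconj.
  exact: sum_Re_weighted.
have FWY := sum_Re_weighted (fun=> 1) y 1 (-1); rewrite -WE in FWY.
have -> : \sum_j q j * (q j - s j) / (s j + t * (q j - s j)) =
   \sum_m \sum_i (sqmod (W m i) * (lam m - mu i) + (1 - t) *
     ((lam m - mu i) * complex.Re (W m i * cconj (Y y m i)) *+ 2
      - (mu i + t * (lam m - mu i)) * sqmod (Y y m i))).
  transitivity (\sum_m \sum_i ((1 * lam m + -1 * mu i) * sqmod (W m i)) +
    (1 - t) * 2 * (\sum_m \sum_i (1 * lam m + -1 * mu i) *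
      complex.Re (W m i * cconj (Y y m i))) -
    (1 - t) * \sum_m \sum_i (t * lam m + (1 - t) * mu i) * sqmod (Y y m i)).
    rewrite FW FY FWY !mulr_sumr -sumrN -!big_split; apply: eq_bigr => j _ /=.
    rewrite /y; have [u0|un0] := eqVneq (s j + t * (q j - s j)) 0; last by field.
    have : (1 - t) * s j + t * q j = 0 by rewrite -u0; ring.
    move/eqP; rewrite paddr_eq0 ?mulr_ge0// ?subr_ge0 ?ltW// => /andP[].
    rewrite !mulf_eq0 subr_eq0 !(gt_eqF t1, gt_eqF t0)/= => /eqP-> /eqP->.
    by ring.
  rewrite !mulr_sumr -sumrN -!big_split; apply: eq_bigr => m _ /=.
  rewrite !mulr_sumr -sumrN -!big_split; apply: eq_bigr => i _ /=; ring.
by apply: ler_sum => m _; apply: ler_sum => i _; exact: resolvent_quadratic_ge.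
Qed.

Hypothesis muE : forall i, mu i = \sum_m lam m * sqmod (W m i).

Lemma marginal_gt0 m i : lam m * sqmod (W m i) != 0 -> 0 < mu i.
Proof.
move=> h; rewrite muE (bigD1 m)//=; apply: ltr_pwDl.
  by rewrite lt0r h mulr_ge0 ?sqmod_ge0.
by apply: sumr_ge0 => k _; rewrite mulr_ge0 ?sqmod_ge0.
Qed.

(** The support of rho lies in that of its pinching: if s_j = 0, every i with mu_i > 0 has V_ij = 0,
    and expanding Z = W V then kills Z_mj whenever lam_m is nonzero. *)
Lemma measured_support j : q j != 0 -> 0 < q j /\ 0 < s j.
Proof.
move=> qn0; split; first by rewrite lt0r qn0 q_ge0.
rewrite lt0r s_ge0 andbT; apply: contra qn0 => s0.
have {s0} sz i : mu i * sqmod (V i j) = 0.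
  move: s0; rewrite psumr_eq0 => [/allP/(_ i)|k _]; last by rewrite mulr_ge0 ?sqmod_ge0.
  by rewrite mem_index_enum => /(_ isT)/eqP.
apply/eqP/big1 => m _.
have [->|ln0] := eqVneq (lam m) 0; first by rewrite mul0r.
suff -> : Z m j = 0 by rewrite (eqP (_ : sqmod 0 == 0)) ?mulr0// sqmod_eq0.
have -> : Z = W *m V by rewrite -mulmxA uV mulmx1.
rewrite mxE; apply: big1 => i _.
have [->|Wn0] := eqVneq (W m i) 0; first by rewrite mul0r.
have mi : 0 < mu i by apply: (@marginal_gt0 m i); rewrite mulf_neq0// sqmod_eq0.
have /eqP := sz i; rewrite mulf_eq0 gt_eqF//= sqmod_eq0 => /eqP ->.
by rewrite mulr0.
Qed.

Lemma entropy_sum_ge :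
  - \sum_j q j * ln (s j) - \sum_m lam m * ln (lam m) <=
  - \sum_i mu i * ln (mu i) - \sum_j q j * ln (q j).
Proof.
(* The left summand carries the relative entropy of rho and sigma, the right one that of q and s
   with the opposite sign, so a single derivative compares them. *)
pose T := (('I_n * 'I_n) + 'I_n)%type.
pose k (t : T) := match t with inl (m, i) => sqmod (W m i) * lam m | inr j => - q j end.
pose x (t : T) := match t with inl (m, i) => mu i | inr j => s j end.
pose y (t : T) := match t with inl (m, i) => lam m | inr j => q j end.
have split_sum (F : T -> R) :
    \sum_t F t = \sum_m \sum_i F (inl (m, i)) + \sum_j F (inr j).
  by rewrite big_sumType/= pair_bigA/=; congr (_ + _); apply: eq_bigr => -[].
have : \sum_t k t * ln (x t) <= \sum_t k t * ln (y t).
  apply: sum_ln_le_of_segment_deriv => [[[m i]|j] /=|t t01].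
  - move=> h; split; last first.
      by rewrite lt0r lam_ge0 andbT; apply: contraNneq h => ->; rewrite mulr0.
    by apply: (@marginal_gt0 m i); rewrite mulrC.
  - by rewrite oppr_eq0 => /measured_support[].
  - rewrite split_sum /= -[X in _ + X]opprK subr_ge0.
    apply: le_trans (measured_log_derivative_le t01).
    by rewrite -sumrN; apply: ler_sum => j _; rewrite !mulNr opprK.
rewrite !split_sum/=.
have -> : \sum_m \sum_i sqmod (W m i) * lam m * ln (mu i) = \sum_i mu i * ln (mu i).
  rewrite exchange_big/=; apply: eq_bigr => i _; rewrite muE mulr_suml.
  by apply: eq_bigr => m _; rewrite (mulrC (sqmod _)).
have -> : \sum_m \sum_i sqmod (W m i) * lam m * ln (lam m) = \sum_m lam m * ln (lam m).
  apply: eq_bigr => m _; under eq_bigr do rewrite -mulrA.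
  by rewrite -mulr_suml unitary_row_sum ?mul1r//; apply: unitaryM => //; exact: unitary_adj.
under eq_bigr do rewrite mulNr.
under [X in _ <= _ + X]eq_bigr do rewrite mulNr.
rewrite !sumrN; lra.
Qed.

End Measurement.

(** * Jensen's inequality for ln and the overlap of two unit vectors *)

Section Overlap.
Variable R : realType.
Local Notation C := (complex R).

Lemma ln_le_subr1 (x : R) : 0 < x -> ln x <= x - 1.
Proof.
by move=> x0; have := @le_ln1Dx R (x - 1); rewrite (addrC 1) subrK; apply; lra.
Qed.

(** Jensen's inequality, from the tangent line of ln at the mean M. *)
Lemma sum_mul_ln_le (T : finType) (q s : T -> R) :
  (forall j, 0 <= q j) -> (forall j, q j != 0 -> 0 < s j) -> \sum_j q j = 1 ->
  0 < \sum_j q j * s j ->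
  \sum_j q j * ln (s j) <= ln (\sum_j q j * s j).
Proof.
set M := \sum_j q j * s j; move=> q0 s0 q1 M0.
have H j : q j * ln (s j) <= q j * ln M + (q j * s j / M - q j).
  have [->|qn0] := eqVneq (q j) 0; first by rewrite !mul0r subr0 addr0.
  have sj := s0 j qn0.
  have : ln (s j / M) <= s j / M - 1 by apply: ln_le_subr1; apply: divr_gt0.
  rewrite ln_div ?posrE// lerBlDl => h.
  have := ler_wpM2l (q0 j) h; rewrite mulrDr mulrBr mulr1 mulrA; lra.
apply: le_trans (ler_sum _ (fun j _ => H j)) _.
rewrite big_split/= sumrB -!mulr_suml q1 divff ?gt_eqF//.
by rewrite mul1r subrr addr0.
Qed.

(* With S = |x|^2 + |z_j|^2, expand 0 <= |S z - x u - z_j e_j|^2 to get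
   S^2 <= S + 2 Re(conj z_j x u_j) <= S (1 + |u_j|). *)
Lemma overlap_sum_le n (z u : 'I_n -> C) (j : 'I_n) :
  \sum_k sqmod (z k) = 1 -> \sum_k sqmod (u k) = 1 ->
  sqmod (\sum_k z k * cconj (u k)) + sqmod (z j) <= 1 + Num.sqrt (sqmod (u j)).
Proof.
move=> z1 u1; set x := \sum_k _; set S := _ + _; set N := Num.sqrt _.
have N0 : 0 <= N := sqrtr_ge0 _.
have NE : N ^+ 2 = sqmod (u j) by rewrite sqr_sqrtr ?sqmod_ge0.
have S0 : 0 <= S by rewrite addr_ge0 ?sqmod_ge0.
pose Sc : C := real_complex R S.
(* The vector to be expanded has squared coordinates f k for k other than j, and g j at j; its
   squared norm is the sum of f plus g j - f j. *)
pose f k := sqmod (Sc * z k - x * u k).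
pose g k := sqmod (Sc * z k - x * u k - z k).
have sumf : \sum_k f k = S ^+ 2 - S * sqmod x *+ 2 + sqmod x.
  have fE k : f k = S ^+ 2 * sqmod (z k) - S * complex.Re (cconj x * (z k * cconj (u k))) *+ 2
     + sqmod x * sqmod (u k).
    rewrite /f /Sc; case: (x) (z k) (u k) => [x1 x2] [z1' z2] [u1' u2].
    rewrite /sqmod/=; ring.
  under eq_bigr do rewrite fE.
  rewrite !big_split/= -!mulr_sumr z1 u1 !mulr1; congr (_ + _ + _).
  rewrite sumrN sumrMnl -mulr_sumr -Re_sum -mulr_sumr -/x.
  by rewrite (mulrC (cconj x)) Re_mul_cconj.
have gfE : g j - f j = sqmod (z j) - S * sqmod (z j) *+ 2
    + complex.Re (cconj (z j) * x * u j) *+ 2.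
  rewrite /f /g /Sc; case: (x) (z j) (u j) => [x1 x2] [z1' z2] [u1' u2].
  rewrite /sqmod/=; ring.
have g0 : 0 <= g j := sqmod_ge0 _.
have fj : f j <= \sum_k f k.
  by rewrite (bigD1 j)//= lerDl sumr_ge0// => k _; exact: sqmod_ge0.
have : complex.Re (cconj (z j) * x * u j) *+ 2 <= N * S.
  have h : (complex.Re (cconj (z j) * x * u j) *+ 2) ^+ 2 <= (N * S) ^+ 2.
    rewrite exprMn NE /S; case: (x) (z j) (u j) => [x1 x2] [z1' z2] [u1' u2].
    rewrite /sqmod/=.
    set re := (X in X *+ 2).
    (* The imaginary part of conj(z_j) x u_j. Dropping it bounds re^2 by the product A B K, and 4 A
       B <= (A + B)^2 finishes. *)
    pose im := (z1' * x1 - - z2 * x2) * u2 + (z1' * x2 + - z2 * x1) * u1'.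
    have e : re ^+ 2 + im ^+ 2 =
        (z1' ^+ 2 + z2 ^+ 2) * (x1 ^+ 2 + x2 ^+ 2) * (u1' ^+ 2 + u2 ^+ 2).
      by rewrite /re /im; ring.
    have im0 := sqr_ge0 im.
    set A := x1 ^+ 2 + x2 ^+ 2 in e *. set B := z1' ^+ 2 + z2 ^+ 2 in e *.
    set K := u1' ^+ 2 + u2 ^+ 2 in e *.
    have K0 : 0 <= K by rewrite addr_ge0 ?sqr_ge0.
    have : 0 <= K * (A - B) ^+ 2 by rewrite mulr_ge0 ?sqr_ge0.
    have -> : (re *+ 2) ^+ 2 = 4 * re ^+ 2 by ring.
    have -> : K * (A - B) ^+ 2 = K * (A + B) ^+ 2 - 4 * (B * A * K) by ring.
    rewrite -e; lra.
  by rewrite leNgt; apply/negP => lt; have := mulr_ge0 N0 S0; nra.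
set T := complex.Re _ *+ 2 in gfE * => TN.
have SE : S * sqmod x *+ 2 + S * sqmod (z j) *+ 2 = S ^+ 2 *+ 2 by rewrite /S; ring.
have : S ^+ 2 <= S * (1 + N).
  have -> : S * (1 + N) = sqmod x + sqmod (z j) + N * S by rewrite {1}/S /S; ring.
  lra.
rewrite expr2; have [->|Sn0] := eqVneq S 0; first by rewrite addr_ge0.
by rewrite ler_pM2l// lt0r Sn0.
Qed.

End Overlap.

(** * Entropy and overlap bounds for the two bases *)

Section Main.
Variables (R : realType) (d : nat) (rho : 'M[complex R]_d)
    (a b : 'I_d -> 'cV[complex R]_d).
Hypotheses (hrho : density_matrix rho) (ha : orthonormal_basis a)
  (hb : orthonormal_basis b).

Let p i := complex.Re (sandwich (a i) rho (a i)).
Let q j := complex.Re (sandwich (b j) rho (b j)).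
Let c i j := sqmod (cdot (a i) (b j)).

Lemma sandwich_spectral (P : 'M[complex R]_d) (lam : 'I_d -> R)
    (e : 'I_d -> 'cV[complex R]_d) i :
  rho = adj P *m rdiag lam *m P ->
  complex.Re (sandwich (e i) rho (e i)) = \sum_m lam m * sqmod ((P *m basis_mx e) m i).
Proof.
move=> ->; rewrite sandwich_basis_mx.
have -> : adj (basis_mx e) *m (adj P *m rdiag lam *m P) *m basis_mx e =
    adj (P *m basis_mx e) *m rdiag lam *m adj (adj (P *m basis_mx e)).
  by rewrite adjK adjM !mulmxA.
by rewrite Re_rdiag_conj; apply: eq_bigr => m _; rewrite adj_mxE sqmodC.
Qed.

Lemma measure_prob (e : 'I_d -> 'cV[complex R]_d) : orthonormal_basis e ->
  (forall i, 0 <= complex.Re (sandwich (e i) rho (e i))) /\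
  \sum_i complex.Re (sandwich (e i) rho (e i)) = 1.
Proof.
move=> he; have [P [lam [uP rhoE lam0 lam1 _]]] := density_spectral hrho; split=> [i|].
  rewrite (sandwich_spectral e i rhoE); apply: sumr_ge0 => m _.
  by rewrite mulr_ge0 ?sqmod_ge0.
under eq_bigr do rewrite (sandwich_spectral e _ rhoE).
rewrite exchange_big/= -lam1; apply: eq_bigr => m _.
rewrite -mulr_sumr unitary_row_sum ?mulr1//.
by apply: unitaryM => //; exact: orthonormal_unitary.
Qed.

(** Instance of [entropy_sum_ge] in which sigma is the pinching of rho in the basis a, so mu = p.
    The first conjunct keeps the logarithms of nonzero weight at positive arguments. *)
Lemma measure_pair_entropy :
  (forall j, q j != 0 -> 0 < \sum_i p i * c i j) /\
  - \sum_j q j * ln (\sum_i p i * c i j) + vN_entropy rho <=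
  - \sum_i p i * ln (p i) - \sum_j q j * ln (q j).
Proof.
have [P [lam [uP rhoE lam0 lam1 ->]]] := density_spectral hrho.
have uA := orthonormal_unitary ha; have uB := orthonormal_unitary hb.
have uZ : unitary (P *m basis_mx b) by exact: unitaryM.
have uV : unitary (adj (basis_mx a) *m basis_mx b).
  by apply: unitaryM => //; exact: unitary_adj.
have WE : P *m basis_mx b *m adj (adj (basis_mx a) *m basis_mx b) = P *m basis_mx a.
  by rewrite adjM adjK !mulmxA -(mulmxA P) (unitaryr uB) mulmx1.
have pE i : p i =
    \sum_m lam m * sqmod ((P *m basis_mx b *m adj (adj (basis_mx a) *m basis_mx b)) m i).
  by rewrite WE; exact: sandwich_spectral.
have qE j : q j = \sum_m lam m * sqmod ((P *m basis_mx b) m j) by exact: sandwich_spectral.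
have sE j : \sum_i p i * c i j = \sum_i p i * sqmod ((adj (basis_mx a) *m basis_mx b) i j).
  by apply: eq_bigr => i _; rewrite adj_basis_mx_mul.
have p0 := (measure_prob ha).1.
split=> [j|].
  by rewrite qE sE => /(measured_support uV lam0 p0 pE)[].
under eq_bigr do rewrite sE qE.
under [X in _ <= _ - X]eq_bigr do rewrite qE.
exact: entropy_sum_ge uZ uV lam0 p0 pE.
Qed.

(** Both p_i and q_j are averages over the eigenvectors of [rho] with weights lam, so it suffices to
    bound each eigenvector by [overlap_sum_le]. *)
Lemma measure_pair_overlap i j : p i + q j <= 1 + Num.sqrt (c i j).
Proof.
have [P [lam [uP rhoE lam0 lam1 _]]] := density_spectral hrho.
have uA := orthonormal_unitary ha; have uB := orthonormal_unitary hb.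
have uZ : unitary (P *m basis_mx b) by exact: unitaryM.
have uV : unitary (adj (basis_mx a) *m basis_mx b).
  by apply: unitaryM => //; exact: unitary_adj.
rewrite /p /q !(sandwich_spectral _ _ rhoE) -big_split/=.
rewrite -[X in _ <= X]mul1r -{1}lam1 mulr_suml; apply: ler_sum => m _.
rewrite -mulrDr ler_wpM2l//.
have -> : (P *m basis_mx a) m i =
    \sum_k (P *m basis_mx b) m k * cconj ((adj (basis_mx a) *m basis_mx b) i k).
  have -> : P *m basis_mx a = P *m basis_mx b *m adj (adj (basis_mx a) *m basis_mx b).
    by rewrite adjM adjK !mulmxA -(mulmxA P) (unitaryr uB) mulmx1.
  by rewrite mxE; apply: eq_bigr => k _; rewrite adj_mxE.
rewrite /c -adj_basis_mx_mul.
exact: (@overlap_sum_le _ _ ((P *m basis_mx b) m) ((adj (basis_mx a) *m basis_mx b) i) j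
  (unitary_row_sum m uZ) (unitary_row_sum i uV)).
Qed.

End Main.

(** * Deduction of the three bounds *)

Unset Implicit Arguments.

Theorem theorem1 (R : realType) (d : nat) (rho : 'M[complex R]_d)
    (a b : 'I_d -> 'cV[complex R]_d) :
  density_matrix rho -> orthonormal_basis a -> orthonormal_basis b ->
  let U := fun i j => cdot (a i) (b j) in
  let p := [seq complex.Re (sandwich (a i) rho (a i)) | i <- enum 'I_d] in
  let q := [seq complex.Re (sandwich (b j) rho (b j)) | j <- enum 'I_d] in
  let pq := [seq complex.Re (sandwich (a i) rho (a i)) *
                 complex.Re (sandwich (b j) rho (b j)) | i <- enum 'I_d, j <- enum 'I_d] in
  let c := decr [seq sqmod (U i j) | i <- enum 'I_d, j <- enum 'I_d] in
  let c1 := nth 0 c 0 in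
  let c2 := nth 0 c 1 in
  let C := (1 + Num.sqrt c1) / 2 in
  let admissible := fun Q : seq R =>
    [/\ prob_vec (d * d) Q, sorted (fun x y : R => y <= x) Q & majorized pq Q] in
  (forall Q : seq R, admissible Q ->
     - ln (sdot (d * d) Q c) + vN_entropy rho <= shannon p + shannon q) /\
  (- ln (c1 * C ^+ 2 + c2 * (1 - C ^+ 2)) + vN_entropy rho <= shannon p + shannon q) /\
  (forall Q : seq R, admissible Q ->
     let h := fun k l =>
       decr [seq sqmod (U k j) * sqmod (U i l) | i <- enum 'I_d, j <- enum 'I_d] in
     let g := incr [seq - ln (sdot (d * d) Q (h k l)) | k <- enum 'I_d, l <- enum 'I_d] in
     2^-1 * sdot (d * d) Q g + vN_entropy rho <= shannon p + shannon q).
Proof.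
move=> hrho ha hb U p q pq c c1 c2 C admissible.
pose pf i := complex.Re (sandwich (a i) rho (a i)).
pose qf j := complex.Re (sandwich (b j) rho (b j)).
pose cf i j := sqmod (U i j).
(* s is the outcome distribution in the basis b after a measurement in a; t is the same with the
   bases exchanged. *)
pose s j := \sum_i pf i * cf i j.
pose t i := \sum_j qf j * cf i j.
have [p0 p1] : (forall i, 0 <= pf i) /\ \sum_i pf i = 1 := measure_prob hrho ha.
have [q0 q1] : (forall j, 0 <= qf j) /\ \sum_j qf j = 1 := measure_prob hrho hb.
pose r := [seq (i, j) | i <- enum 'I_d, j <- enum 'I_d].
have szr : size r = (d * d)%N by rewrite size_allpairs size_enum_ord.
have map_r (F : 'I_d -> 'I_d -> R) :
    [seq F i j | i <- enum 'I_d, j <- enum 'I_d] = [seq F x.1 x.2 | x <- r].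
  by rewrite map_allpairs.
have big_r (F : 'I_d -> 'I_d -> R) :
    \sum_(x <- r) F x.1 x.2 = \sum_i \sum_j F i j.
  by rewrite big_allpairs_dep big_enum; apply: eq_bigr => i _; rewrite big_enum.
have HE : shannon p + shannon q = - \sum_i pf i * ln (pf i) - \sum_j qf j * ln (qf j).
  by rewrite /shannon /p /q big_map big_enum big_map big_enum.
have [s_gt0 Eq] : (forall j, qf j != 0 -> 0 < s j) /\
    - \sum_j qf j * ln (s j) + vN_entropy rho <= shannon p + shannon q.
  by rewrite HE; exact: measure_pair_entropy.
have tE i : t i = \sum_j qf j * sqmod (cdot (b j) (a i)).
  by apply: eq_bigr => j _; rewrite /cf /U -sqmodC cconj_cdot.
have [t_gt0 Ep] : (forall i, pf i != 0 -> 0 < t i) /\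
    - \sum_i pf i * ln (t i) + vN_entropy rho <= shannon p + shannon q.
  have [h1 h2] := measure_pair_entropy hrho hb ha; split=> [i|].
    by rewrite tE; exact: h1.
  by under eq_bigr do rewrite tE; rewrite HE (addrC (- _) (- \sum_j _)).
(* The mean overlap under p tensor q. Parts (i) and (ii) are two upper bounds on it. *)
pose M := \sum_i \sum_j pf i * qf j * cf i j.
have ME : M = \sum_j qf j * s j.
  rewrite /M exchange_big; apply: eq_bigr => j _; rewrite mulr_sumr.
  by apply: eq_bigr => i _; rewrite mulrCA mulrA.
have M_gt0 : 0 < M.
  have [j qj] : exists j, qf j != 0.
    apply/existsP; apply: contraT; rewrite negb_exists => /forallP z.
    have := q1; rewrite big1 => [/esym/eqP|j _]; first by rewrite oner_eq0.
    by apply/eqP; have := z j; rewrite negbK.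
  rewrite ME (bigD1 j)//=; apply: ltr_pwDl.
    by rewrite mulr_gt0 ?s_gt0// lt0r qj q0.
  apply: sumr_ge0 => k _; have [->|qk] := eqVneq (qf k) 0; first by rewrite mul0r.
  by rewrite mulr_ge0 ?q0// ltW ?s_gt0.
have EM : - ln M + vN_entropy rho <= shannon p + shannon q.
  apply: le_trans Eq; rewrite lerD2r lerN2 ME; apply: sum_mul_ln_le => //.
  by rewrite -ME.
have EMle x : M <= x -> - ln x + vN_entropy rho <= shannon p + shannon q.
  move=> Mx; apply: le_trans EM; rewrite lerD2r lerN2 ler_ln ?posrE//.
  exact: lt_le_trans Mx.
have maj Q F : admissible Q -> \sum_i \sum_j pf i * qf j * F i j <=
    sdot (d * d) Q (decr [seq F i j | i <- enum 'I_d, j <- enum 'I_d]).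
  case=> _ sQ mQ; rewrite map_r -szr -(big_r (fun i j => pf i * qf j * F i j)).
  by apply: majorized_sum_mul_le => //; rewrite -(map_r (fun i j => pf i * qf j)).
split; [|split].
- by move=> Q aQ; apply: EMle; exact: maj.
- apply: EMle.
  have rn0 : r != [::].
    apply/eqP => r0; move: M_gt0.
    by rewrite /M -(big_r (fun i j => pf i * qf j * cf i j)) r0 big_nil ltxx.
  (* With w the weight at the largest overlap, M <= w c1 + (1 - w) c2. This is nondecreasing in w
     because c2 <= c1, so w may be replaced by its bound C^2. *)
  have [[i0 j0] x0r [/= c1E c2P]] := decr_second (fun x => cf x.1 x.2) rn0.
  rewrite -map_r -/c -/c1 -/c2 in c1E c2P.
  have tot : \sum_(x <- r) pf x.1 * qf x.2 = 1.
    rewrite (big_r (fun i j => pf i * qf j)) -p1; apply: eq_bigr => i _.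
    by rewrite -mulr_sumr q1 mulr1.
  rewrite /M -(big_r (fun i j => pf i * qf j * cf i j)).
  move: tot; rewrite !(perm_big _ (perm_to_rem x0r))/= !big_cons/= c1E => tot.
  have rest : \sum_(x <- rem (i0, j0) r) pf x.1 * qf x.2 * cf x.1 x.2 <=
      (\sum_(x <- rem (i0, j0) r) pf x.1 * qf x.2) * c2.
    rewrite mulr_suml !big_seq; apply: ler_sum => x xr.
    by rewrite ler_wpM2l ?mulr_ge0 ?p0 ?q0// c2P.
  have pqC : pf i0 * qf j0 <= C ^+ 2.
    have : pf i0 + qf j0 <= C *+ 2.
      rewrite /C -c1E; have := measure_pair_overlap hrho ha hb i0 j0.
      rewrite -/(pf i0) -/(qf j0) -/(cf i0 j0); lra.
    move: (p0 i0) (q0 j0); move: (pf i0) (qf j0) => x y x0 y0 xyC.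
    have : (x + y) ^+ 2 <= (C *+ 2) ^+ 2.
      have xy0 := addr_ge0 x0 y0.
      by rewrite ler_pXn2r// nnegrE//; exact: le_trans xy0 xyC.
    have := sqr_ge0 (x - y); lra.
  (* For d = 1 the second entry is the default 0, so nonnegativity of the overlaps is used besides
     sortedness. *)
  have c21 : c2 <= c1.
    have := decr_sorted [seq sqmod (U i j) | i <- enum 'I_d, j <- enum 'I_d].
    rewrite -/c /c1 /c2; have : all (fun x => 0 <= x) c.
      rewrite (perm_all _ (perm_decr _)) map_r all_map; apply/allP => x _.
      exact: sqmod_ge0.
    by case: (c) => [|x [|y v]]//=; [case/andP|move=> _ /andP[]].
  have := ler_wpM2r (_ : 0 <= c1 - c2) pqC.
  rewrite subr_ge0 => /(_ c21).
  move: rest; rewrite -(_ : 1 - pf i0 * qf j0 = \sum_(x <- rem (i0, j0) r) pf x.1 * qf x.2);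
    last by rewrite -tot addrAC subrr add0r.
  lra.
- move=> Q aQ.
  pose h k l := decr [seq sqmod (U k j) * sqmod (U i l) | i <- enum 'I_d, j <- enum 'I_d].
  pose g := incr [seq - ln (sdot (d * d) Q (h k l)) | k <- enum 'I_d, l <- enum 'I_d].
  change (2^-1 * sdot (d * d) Q g + vN_entropy rho <= shannon p + shannon q).
  pose G k l := - ln (sdot (d * d) Q (h k l)).
  have gE : sdot (d * d) Q g <= \sum_k \sum_l pf k * qf l * G k l.
    case: aQ => _ sQ mQ.
    rewrite -(big_r (fun k l => pf k * qf l * G k l)) /g map_r.
    have {}mQ : majorized [seq pf x.1 * qf x.2 | x <- r] Q.
      by rewrite -(map_r (fun i j => pf i * qf j)).
    by have := majorized_sum_mul_ge (fun x => G x.1 x.2) sQ mQ; rewrite szr.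
  (* Half the sum of [Eq] and [Ep], combined with [gE], reduces the claim to this comparison. *)
  suff GE : \sum_k \sum_l pf k * qf l * G k l <=
      - \sum_j qf j * ln (s j) - \sum_i pf i * ln (t i) by lra.
  (* Since p and q each sum to 1, both sums become averages over pairs (k, l), to be compared term
     by term. *)
  have -> : - \sum_j qf j * ln (s j) - \sum_i pf i * ln (t i) =
      \sum_k \sum_l pf k * qf l * (- ln (s l) - ln (t k)).
    transitivity (\sum_k \sum_l pf k * (qf l * - ln (s l)) +
        \sum_k \sum_l qf l * (pf k * - ln (t k))).
      congr (_ + _).
        under [RHS]eq_bigr do rewrite -mulr_sumr.
        by rewrite -mulr_suml p1 mul1r -sumrN; apply: eq_bigr => l _; rewrite mulrN.
      under [RHS]eq_bigr do rewrite -mulr_suml q1 mul1r.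
      by rewrite -sumrN; apply: eq_bigr => k _; rewrite mulrN.
    rewrite -big_split; apply: eq_bigr => k _ /=.
    by rewrite -big_split; apply: eq_bigr => l _ /=; ring.
  apply: ler_sum => k _; apply: ler_sum => l _.
  have [->|pk] := eqVneq (pf k) 0; first by rewrite !mul0r.
  have [->|ql] := eqVneq (qf l) 0; first by rewrite mulr0 !mul0r.
  rewrite ler_wpM2l ?mulr_ge0 ?p0 ?q0// /G -opprD lerN2.
  rewrite -lnM ?posrE ?s_gt0 ?t_gt0//.
  (* The product expands to the p tensor q average of |U_il|^2 |U_kj|^2 over (i, j), to which the
     rearrangement bound applies. *)
  have le : s l * t k <= sdot (d * d) Q (h k l).
    apply: le_trans (maj Q (fun i j => sqmod (U k j) * sqmod (U i l)) aQ).
    rewrite /s /t mulr_suml; apply: ler_sum => i _; rewrite mulr_sumr.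
    by apply: ler_sum => j _; rewrite /cf; lra.
  have st : 0 < s l * t k by rewrite mulr_gt0 ?s_gt0 ?t_gt0.
  by rewrite ler_ln ?posrE// (lt_le_trans st).
Qed.
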